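(* Let $k,m\ge1$ be integers, $\lambda\in[\tfrac1m,1]$, $t=\lfloor 1/\lambda\rfloor$, and let $W\sim\mathrm{Bin}(t,\tfrac1k)$. Let $$\mathsf{R}_d^\star(\lambda)=\max_{P_{B^m}}\ \min_{\substack{Q_X\in\Delta_m\\ \|Q_X\|_\infty\le\lambda}}\ \mathbb{E}_{B^m\sim P_{B^m}}\big[\mathsf{R}_d(Q_X,B^m)\big],$$ where $P_{B^m}$ ranges over all probability distributions on $[k]^m$ and $\mathsf{R}_d(Q_X,b^m)$ is the detection probability of the Correlated Channel watermark, and let $$\tilde{\mathsf{R}}_d^\star(\lambda)=1-\frac1{2k}-\frac14\sum_{c=0}^{t}\Pr[W=c]\left(\left|(c-t)\lambda+\Big(1-\frac1k\Big)\right|+(k-1)\left|c\lambda-\frac1k\right|\right).$$ Then $$\left|\tilde{\mathsf{R}}_d^\star(\lambda)-\mathsf{R}_d^\star(\lambda)\right|\le\frac{2k\lceil 1/\lambda\rceil}{m};$$ in particular the approximation error is $O(1/m)$ for fixed $k$ and $\lambda$.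
   Context: $\mathcal{X}=[m]=\{1,\dots,m\}$ is the token vocabulary, $\mathcal{S}=[k]$, $\Delta_m$ is the probability simplex on $[m]$, $\|Q\|_\infty=\max_x Q(x)$. Correlated Channel (CC) watermark: let $S$ be uniform on $[k]$. For $Q_X\in\Delta_m$ and $b^m=(b_1,\dots,b_m)\in[k]^m$, let $Y=b_X$ with $X\sim Q_X$, so $P_Y(s)=\sum_{x:b_x=s}Q_X(x)$. Choose a coupling $P_{S,Y}$ of the uniform distribution $P_S$ and $P_Y$ maximizing $\Pr(S=Y)$, and define the watermarked token distribution given $S=s$ by $Q_{X|s,b^m}(x)=Q_X(x)\,P_{S|Y}(s\mid b_x)/P_S(s)$. A fair coin $C$, independent of everything else, is flipped; if $C=0$ the token $A\sim Q_X$ is drawn independently of $S$, and if $C=1$ then $A\sim Q_{X|S,b^m}$. The detector declares ''watermarked'' if and only if $b_A=S$. The detection probability is $$\mathsf{R}_d(Q_X,b^m)=\tfrac12\Pr(b_A=S\mid C=1)+\tfrac12\Pr(b_A\ne S\mid C=0).$$ *)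

(* Defs.v *)
From HB Require Import structures.
From mathcomp Require Import all_boot all_order all_algebra.
From mathcomp Require Import all_classical all_reals all_analysis.

Set Implicit Arguments.
Unset Strict Implicit.
Unset Printing Implicit Defensive.

Import Order.TTheory GRing.Theory Num.Theory.
Import numFieldNormedType.Exports.

Local Open Scope classical_set_scope.
Local Open Scope ring_scope.

Section Watermark.
Variable R : realType.

Definition is_pmf (T : finType) (p : T -> R) : Prop :=
  (forall x, 0 <= p x) /\ \sum_x p x = 1.

(* Token distributions Q_X on [m] with sup-norm at most lam. *)
Definition capped_pmf (m : nat) (lam : R) (Q : 'I_m -> R) : Prop :=
  is_pmf Q /\ \big[Num.max/0]_(x : 'I_m) Q x <= lam.

Definition is_coupling (T U : finType) (p : T -> R) (q : U -> R)
    (J : T -> U -> R) : Prop :=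
  [/\ forall s y, 0 <= J s y,
      forall s, \sum_y J s y = p s
    & forall y, \sum_s J s y = q y].

Definition is_max_coupling (T : finType) (p q : T -> R) (J : T -> T -> R) :
    Prop :=
  is_coupling p q J /\
  forall J', is_coupling p q J' -> \sum_s J' s s <= \sum_s J s s.

Section CorrelatedChannel.
Variables (k m : nat).
Implicit Types (Q : 'I_m -> R) (b : {ffun 'I_m -> 'I_k}).

Definition P_S : 'I_k -> R := fun=> k%:R^-1.

Definition P_Y Q b (s : 'I_k) : R := \sum_(x | b x == s) Q x.

(* J is the joint law of (S, Y).  J s (b x) / P_Y Q b (b x) is
   P_{S|Y}(s | b_x); if P_Y Q b (b x) = 0 it is 0 by the convention on inverses,
   which is harmless since then Q x = 0. *)
Definition Q_wm Q b (J : 'I_k -> 'I_k -> R) (s : 'I_k) (x : 'I_m) : R :=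
  Q x * (J s (b x) / P_Y Q b (b x)) / P_S s.

(* Conditional law of the token A given S = s and C = c. *)
Definition token_law Q b J (c : bool) (s : 'I_k) : 'I_m -> R :=
  if c then Q_wm Q b J s else Q.

(* S is independent of the fair coin C, hence uniform given C = c. *)
Definition detection Q b (J : 'I_k -> 'I_k -> R) : R :=
  2^-1 * (\sum_s P_S s * \sum_(x | b x == s) token_law Q b J true s x) +
  2^-1 * (\sum_s P_S s * \sum_(x | b x != s) token_law Q b J false s x).

(* Maximal couplings need not be unique: a rule fixes one for each (Q, b). *)
Definition coupling_rule : Type :=
  ('I_m -> R) -> {ffun 'I_m -> 'I_k} -> 'I_k -> 'I_k -> R.

Definition maximal_rule (cpl : coupling_rule) : Prop :=
  forall Q b, is_pmf Q -> is_max_coupling P_S (P_Y Q b) (cpl Q b).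

Variable cpl : coupling_rule.

Definition Rd Q b : R := detection Q b (cpl Q b).

Definition ERd (P : {ffun 'I_m -> 'I_k} -> R) Q : R := \sum_b P b * Rd Q b.

Definition payoffs (lam : R) (P : {ffun 'I_m -> 'I_k} -> R) : set R :=
  [set ERd P Q | Q in @capped_pmf m lam].

Definition worst_cases (lam : R) : set R :=
  [set inf (payoffs lam P) | P in @is_pmf {ffun 'I_m -> 'I_k}].

Definition Rd_star (lam : R) : R := sup (worst_cases lam).

(* The infima and the supremum in Rd_star are a minimum and a maximum. *)
Definition max_min_attained (lam : R) : Prop :=
  (forall P, is_pmf P -> payoffs lam P (inf (payoffs lam P)) /\
                         lbound (payoffs lam P) (inf (payoffs lam P))) /\
  worst_cases lam (Rd_star lam) /\ ubound (worst_cases lam) (Rd_star lam).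

End CorrelatedChannel.

Definition Rd_tilde (k : nat) (lam : R) : R :=
  let t := Num.truncn lam^-1 in
  1 - (2 * k%:R)^-1 -
  4^-1 * \sum_(0 <= c < t.+1) binomial_pmf t k%:R^-1 c *
    (`|(c%:R - t%:R) * lam + (1 - k%:R^-1)| +
     (k%:R - 1) * `|c%:R * lam - k%:R^-1|).

End Watermark.

(* Main.v *)
(** A maximal coupling of the uniform law with [P_Y] has diagonal mass
    [1 - TV], so [Rd Q b = 1 - 1/(2k) - 1/4 * \sum_s |P_Y s - 1/k|], which is
    concave in [Q].  Transferring mass between two coordinates lying strictly
    between [0] and [lam] shows that every payoff is minimised at a permutation
    of the vector with [t] entries [lam] and one entry [1 - t * lam].

    By symmetry the max-min is therefore [\max_b V b], where [V b] averages
    [Rd] over all these permutations.  [V b] depends on [b] only through the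
    class sizes [n_s], as [V b = 1 - 1/(2k) - 1/4 * \sum_s G n_s], and
    [Rd_tilde] is the mean of [V b] over i.i.d. uniform labels.  Exchanging two
    tokens shows [0 <= G n.+2 - 2 * G n.+1 + G n <= 4N/m^2] with
    [N = ceil (1/lam)].  Convexity bounds [\sum_s G n_s] below by its tangent at
    [m/k], and the curvature bound together with the variance of [n_s] bounds its
    mean above, so that [0 <= Rd_star - Rd_tilde <= N/(2m)]. *)
Require Import Defs.
From mathcomp Require Import all_boot all_order all_algebra.
From mathcomp Require Import fingroup perm ring lra zify.
From mathcomp Require Import all_classical all_reals all_analysis.
Import Order.TTheory GRing.Theory Num.Theory.
Import numFieldNormedType.Exports.
Local Open Scope classical_set_scope.
Local Open Scope ring_scope.

(** * Maximal couplings *)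

(** Each diagonal entry is at most both of its marginals. Equality is reached by putting the minimum
    on the diagonal and coupling the two excesses independently. *)
Lemma max_coupling_diag (R : realType) (T : finType) (p q : T -> R)
    (J : T -> T -> R) :
  is_pmf p -> is_pmf q -> is_max_coupling p q J ->
  \sum_s J s s = \sum_s Num.min (p s) (q s).
Proof.
move=> [p0 p1] [q0 q1] [[J0 Jp Jq] Jmax].
apply/eqP; rewrite eq_le; apply/andP; split.
  apply: ler_sum => s _; rewrite le_min; apply/andP; split.
    by rewrite -(Jp s) (bigD1 s) //= lerDl sumr_ge0.
  by rewrite -(Jq s) (bigD1 s) //= lerDl sumr_ge0.
pose mn s := Num.min (p s) (q s).
have mnp s : mn s <= p s by rewrite ge_min lexx.
have mnq s : mn s <= q s by rewrite ge_min lexx orbT.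
pose d := 1 - \sum_s mn s.
have dp : \sum_s (p s - mn s) = d by rewrite sumrB p1.
have dq : \sum_s (q s - mn s) = d by rewrite sumrB q1.
have d0 : 0 <= d by rewrite -dp sumr_ge0 // => s _; rewrite subr_ge0.
(* If [d = 0], both excesses vanish identically, so the marginals stay correct although the quotient
   defaults to [0]; [divd] covers both cases. *)
pose J' s y := (if s == y then mn s else 0) + (p s - mn s) * (q y - mn y) / d.
have mn_ge0 s : 0 <= mn s by rewrite le_min p0 q0.
have J'ge s y : (if s == y then mn s else 0) <= J' s y.
  by rewrite lerDl divr_ge0 // mulr_ge0 // subr_ge0; [exact: mnp|exact: mnq].
have divd (f : T -> R) s : (forall s, 0 <= f s) -> \sum_s f s = d ->
    f s * d / d = f s.
  move=> f0 fd; have [dz|dn] := eqVneq d 0; last by rewrite mulfK.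
  rewrite dz mulr0 mul0r; move: fd; rewrite dz => /eqP.
  by rewrite psumr_eq0 // => /allP/(_ s); rewrite mem_index_enum => /(_ isT)/eqP.
have J'c : is_coupling p q J'.
  split.
  - by move=> s y; apply: le_trans (J'ge s y); case: eqP.
  - move=> s; rewrite big_split /= -big_mkcond /= (big_pred1 s); last first.
      by move=> y; rewrite /= eq_sym.
    rewrite -mulr_suml -mulr_sumr dq (divd (fun s => p s - mn s)) ?subrKC //.
    by move=> x; rewrite subr_ge0.
  - move=> y; rewrite big_split /= -big_mkcond /= big_pred1_eq -mulr_suml.
    rewrite -mulr_suml dp [d * _]mulrC.
    rewrite (divd (fun s => q s - mn s)) ?subrKC //.
    by move=> x; rewrite subr_ge0.
apply: le_trans (Jmax _ J'c); apply: ler_sum => s _.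
by have := J'ge s s; rewrite eqxx.
Qed.

Lemma is_pmf_P_Y (R : realType) (k m : nat) (Q : 'I_m -> R)
    (b : {ffun 'I_m -> 'I_k}) : is_pmf Q -> is_pmf (P_Y Q b).
Proof.
move=> [Q0 Q1]; split; first by move=> s; apply: sumr_ge0.
by rewrite -Q1 [RHS](partition_big b xpredT).
Qed.

Lemma is_pmf_uniform (R : realType) (T : finType) : (0 < #|T|)%N ->
  is_pmf (fun _ : T => #|T|%:R^-1 : R).
Proof.
move=> T0; split=> [x|]; first by rewrite invr_ge0 ler0n.
by rewrite sumr_const -[_^-1]mul1r -mulrnAl divff // pnatr_eq0 -lt0n.
Qed.

(** Under [C = 1] detection is the event [S = Y], so its probability is the diagonal mass of the
    coupling. Under [C = 0] the token is independent of the uniform [S], so a false alarm has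
    probability [1/k]. *)
Lemma RdE (R : realType) (k m : nat) (cpl : coupling_rule R k m)
    (Q : 'I_m -> R) (b : {ffun 'I_m -> 'I_k}) :
  (0 < k)%N -> maximal_rule cpl -> is_pmf Q ->
  Rd cpl Q b = 1 - (2 * k%:R)^-1 - 4^-1 * \sum_s `|P_Y Q b s - k%:R^-1|.
Proof.
move=> k0 hcpl Qp; have [Q0 Q1] := Qp.
have Pp := @is_pmf_P_Y R k m Q b Qp.
have Up : is_pmf (@P_S R k).
  by have := @is_pmf_uniform R 'I_k; rewrite card_ord; apply.
have [[J0 Jp Jq] _] := hcpl Q b Qp.
have kn0 : k%:R != 0 :> R by rewrite pnatr_eq0 -lt0n.
have -> : Rd cpl Q b = 2^-1 * (\sum_s cpl Q b s s) + 2^-1 * (1 - k%:R^-1).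
  rewrite /Rd /detection; congr (_ * _ + _ * _).
    apply: eq_bigr => s _.
    rewrite (eq_bigr (fun x => Q x * (cpl Q b s s / P_Y Q b s) / P_S R s)).
      rewrite -!mulr_suml -/(P_Y Q b s) mulrC divfK ?invr_neq0 //.
      (* A null label has a null column in the coupling, which matches the default value of the
         quotient. *)
      have [z|nz] := eqVneq (P_Y Q b s) 0; last by rewrite mulrC divfK.
      rewrite z mul0r; have := Jq s; rewrite z => /eqP.
      by rewrite psumr_eq0 // => /allP/(_ s); rewrite mem_index_enum => /(_ isT)/eqP.
    by move=> x /eqP bx; rewrite /token_law /Q_wm bx.
  rewrite (eq_bigr (fun s => P_S R s - P_S R s * P_Y Q b s)); last first.
    move=> s _; rewrite -{2}[P_S R s]mulr1 -mulrBr -Q1; congr (_ * _).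
    by rewrite [in RHS](bigID (fun x => b x == s)) /= addrC addrK.
  by rewrite sumrB (proj2 Up) -mulr_sumr (proj2 Pp) mulr1.
rewrite (max_coupling_diag _ _ _ _ _ Up Pp (hcpl _ _ Qp)).
have -> : \sum_s Num.min (P_S R s) (P_Y Q b s)
        = 1 - 2^-1 * \sum_s `|P_Y Q b s - k%:R^-1|.
  (* Splitting [1] over both laws reduces the claim to [min(a, b) = (a + b - |a - b|) / 2]
     termwise. *)
  have e1 : 1 = 2^-1 * (\sum_(s < k) P_S R s + \sum_s P_Y Q b s) :> R.
    by rewrite (proj2 Up) (proj2 Pp); lra.
  rewrite [X in X - _]e1 -big_split /= -mulrBr -sumrB mulr_sumr; apply: eq_bigr => s _.
  rewrite /P_S; case: leP => h.
    by rewrite ger0_norm ?subr_ge0 //; lra.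
  by rewrite ltr0_norm ?subr_lt0 //; lra.
rewrite invfM; lra.
Qed.

(** * Extreme points of the capped simplex *)

(** Equal fibre sizes mean that the two value tuples agree as multisets. *)
Lemma perm_of_fibers (m : nat) (U : eqType) (f g : 'I_m -> U) :
  (forall u, #|[pred x | f x == u]| = #|[pred x | g x == u]|) ->
  exists s : 'S_m, forall x, f x = g (s x).
Proof.
move=> fg.
have : perm_eq [tuple f x | x < m] [tuple g x | x < m].
  apply/allP => u _ /=; rewrite !count_map; apply/eqP.
  by have := fg u; rewrite !cardE /enum_mem !size_filter -!enumT.
move/tuple_permP => [s /= e]; exists s => x.
have := congr1 (fun l => nth (f x) l x) e.
by rewrite !(nth_map x) -?enumT ?size_enum_ord // !nth_ord_enum tnth_mktuple.
Qed.

Section Vertices.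
Context {R : realType} {m : nat} (lam : R).
Hypotheses (lam0 : 0 < lam) (hm : m%:R^-1 <= lam).
Local Notation t := (Num.truncn lam^-1).

Lemma capped_pmfP (Q : 'I_m -> R) :
  capped_pmf lam Q <->
  [/\ forall x, 0 <= Q x, \sum_x Q x = 1 & forall x, Q x <= lam].
Proof.
rewrite /capped_pmf /is_pmf; split=> [[[Q0 Q1] /bigmax_leP[_ Ql]]|[Q0 Q1 Ql]].
  by split=> // x; apply: Ql.
by split=> //; apply/bigmax_leP; split=> //; apply: ltW.
Qed.

(** If [t = m], no index carries the remainder, but then the remainder is [0] ([remainder_eq0]) and
    the total mass is still [1]. *)
Definition extremal (i : 'I_m) : R :=
  if (i < t)%N then lam else if i == t :> nat then 1 - t%:R * lam else 0.

Lemma truncn_bounds : t%:R * lam <= 1 < t.+1%:R * lam.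
Proof.
have /andP[h1 h2] : t%:R <= lam^-1 < t.+1%:R by apply: truncn_itv; rewrite invr_ge0 ltW.
by rewrite -ler_pdivlMr // -ltr_pdivrMr // !div1r h1.
Qed.

Lemma truncn_le_card : (0 < m)%N -> (t <= m)%N.
Proof.
move=> m0; rewrite -(ler_nat R) -(ler_pM2r lam0).
have /andP[h _] := truncn_bounds; apply: le_trans h _.
by rewrite mulrC -ler_pdivrMr ?ltr0n // div1r.
Qed.

Lemma remainder_eq0 : (0 < m)%N -> (m <= t)%N -> 1 - t%:R * lam = 0.
Proof.
move=> m0 mt; have tm : t = m by apply/eqP; rewrite eqn_leq mt truncn_le_card.
apply/eqP; rewrite subr_eq0 eq_le; have /andP[-> _] := truncn_bounds.
by rewrite tm andbT -ler_pdivrMl ?ltr0n // mulr1.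
Qed.

Lemma sum_extremal (F : R -> R) : (0 < m)%N -> F 0 = 0 ->
  \sum_i F (extremal i) = t%:R * F lam + F (1 - t%:R * lam).
Proof.
move=> m0 F0.
pose c (i : nat) := F (if (i < t)%N then lam else
                       if i == t then 1 - t%:R * lam else 0).
rewrite -[LHS]/(\sum_(i < m) c i).
have lo : \sum_(i < t) c i = t%:R * F lam.
  rewrite (eq_bigr (fun=> F lam)) ?sumr_const ?card_ord ?mulr_natl //.
  by move=> i _; rewrite /c ltn_ord.
have [tm|mt] := ltnP t m; last first.
  have tm : t = m by apply/eqP; rewrite eqn_leq mt truncn_le_card.
  rewrite -[in LHS]tm lo.
  suff -> : 1 - t%:R * lam = 0 by rewrite F0 addr0.
  apply/eqP; rewrite subr_eq0 eq_le; have /andP[-> _] := truncn_bounds.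
  by rewrite tm andbT -ler_pdivrMl ?ltr0n // mulr1.
rewrite -(big_mkord xpredT) (big_cat_nat (leq0n _) (ltnW tm)) /= big_mkord lo.
rewrite big_ltn // /c ltnn eqxx big_nat big1 ?addr0 // => i /andP[h _].
by rewrite ltnNge (ltnW h) /= gtn_eqF.
Qed.

Lemma capped_extremal : (0 < m)%N -> capped_pmf lam extremal.
Proof.
move=> m0; have /andP[h1 h2] := truncn_bounds; apply/capped_pmfP.
split=> [i||i]; last 2 first.
- by rewrite (sum_extremal id) //; lra.
- rewrite -natr1 in h2; rewrite /extremal; case: ifP => // _; case: ifP => _; lra.
by rewrite /extremal; case: ifP => _; [lra|case: ifP => _; lra].
Qed.

Lemma capped_perm (Q : 'I_m -> R) (s : 'S_m) :
  capped_pmf lam Q -> capped_pmf lam (fun x => Q (s x)).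
Proof.
move=> /capped_pmfP[Q0 Q1 Ql]; apply/capped_pmfP; split=> //.
by rewrite -Q1 [RHS](reindex_inj (@perm_inj _ s)).
Qed.

Definition interior_set (Q : 'I_m -> R) : {set 'I_m} :=
  finset (fun x => 0 < Q x < lam).

(** The mass equation reads [1 = a * lam + r] with [0 <= r < lam], where [a] counts the entries
    [lam] and [r] is the interior entry, if any. Hence [a = t] and [r = 1 - t * lam], and the
    multiset of values does not depend on [Q]. *)
Lemma near_vertex_fibers (Q : 'I_m -> R) : capped_pmf lam Q ->
  (#|interior_set Q| <= 1)%N -> forall u, #|[pred x | Q x == u]| =
    if u == lam then t else
    if u == 0 then (m - t - (1 - t%:R * lam != 0)%R)%N
    else nat_of_bool (u == 1 - t%:R * lam).
Proof.
move=> /capped_pmfP[Q0 Q1 Ql] I1.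
set a := #|[pred x | Q x == lam]|.
have Qc x : [|| Q x == lam, Q x == 0 | x \in interior_set Q].
  rewrite inE; have := Q0 x; have := Ql x; rewrite !le_eqVlt [0 == _]eq_sym.
  by case: eqP => //= _ ->; case: eqP => //= _ ->.
have sumE : 1 = a%:R * lam + \sum_(x in interior_set Q) Q x.
  rewrite -[LHS]Q1 mulr_natl -sumr_const.
  rewrite [X in _ = X + _]big_mkcond [X in _ = _ + X]big_mkcond /=.
  rewrite -big_split /=; apply: eq_bigr => x _; rewrite !inE.
  have [->|n1] := eqVneq (Q x) lam; first by rewrite ltxx andbF addr0.
  have := Qc x; rewrite (negPf n1) inE /= add0r.
  by case: (eqVneq (Q x) 0) => [->|_ /= ->] //; rewrite ltxx.
have cardm : (a + #|[pred x | Q x == 0%R]| + #|interior_set Q| = m)%N.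
  rewrite -[RHS]card_ord /a -!sum1_card big_mkcond.
  rewrite [X in (_ + X + _)%N]big_mkcond.
  rewrite [X in (_ + X)%N]big_mkcond [RHS]big_mkcond /= -!big_split /=.
  apply: eq_bigr => x _; rewrite !inE; have := Qc x; rewrite inE.
  have [->|n1] := eqVneq (Q x) lam; first by rewrite gt_eqF // ltxx andbF.
  by have [->|n2] := eqVneq (Q x) 0; rewrite ?ltxx //= => ->.
have aP : t = a /\ #|interior_set Q| = nat_of_bool (1 - t%:R * lam != 0) /\
          (forall x, x \in interior_set Q -> Q x = 1 - t%:R * lam).
  (* Uniqueness of the quotient in the division of [1] by [lam]. *)
  have ta r : 0 <= r < lam -> 1 = a%:R * lam + r -> t = a.
    move=> /andP[r0 rl] e; apply: truncn_def.
    rewrite -[lam^-1]mul1r ler_pdivlMr // ltr_pdivrMr // -natr1.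
    by apply/andP; split; lra.
  move: I1; rewrite leq_eqVlt ltnS leqn0 => /orP[/cards1P[x0 e]|].
    have : x0 \in interior_set Q by rewrite e inE.
    rewrite inE => /andP[q0 ql]; rewrite e big_set1 in sumE.
    have -> : t = a by apply: (ta (Q x0)) => //; rewrite (ltW q0).
    have re : 1 - a%:R * lam = Q x0 by lra.
    by rewrite e cards1 re gt_eqF //; split=> //; split=> // x; rewrite inE => /eqP->.
  rewrite cards_eq0 => /eqP e; rewrite e big_set0 in sumE.
  have -> : t = a by apply: (ta 0) => //; rewrite lexx.
  have re : 1 - a%:R * lam = 0 by lra.
  by rewrite e cards0 re eqxx; split=> //; split=> // x; rewrite inE.
have [ta [cI vI]] := aP => u.
case: eqP => [->|/eqP ul]; first by rewrite ta.
case: eqP => [->|/eqP u0]; first by rewrite -cI ta; move: cardm; lia.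
have -> : #|[pred x | Q x == u]| = #|[pred x in interior_set Q | Q x == u]|.
  apply: eq_card => x; rewrite !inE /=; case: eqP => [e|]; last by rewrite andbF.
  by have := Qc x; rewrite e (negPf ul) (negPf u0) /= inE e => ->.
have [e|ne] := eqVneq u (1 - t%:R * lam).
  have -> : true = (1 - t%:R * lam != 0) by rewrite -e u0.
  rewrite -cI e; apply: eq_card => x; rewrite !inE.
  by have := vI x; rewrite inE; case: (_ && _) => //= ->; rewrite // eqxx.
apply: eq_card0 => x; rewrite !inE; apply/negP => /andP[h /eqP h2].
by move: ne; rewrite -h2 vI ?eqxx // inE.
Qed.

Lemma near_vertex_extremal (Q : 'I_m -> R) : (0 < m)%N -> capped_pmf lam Q ->
  (#|interior_set Q| <= 1)%N ->
  exists s : 'S_m, Q = fun x => extremal (s x).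
Proof.
move=> m0 Qc I1.
have [|s Qs] := @perm_of_fibers m _ Q extremal.
  move=> u; rewrite near_vertex_fibers // near_vertex_fibers //.
    exact: capped_extremal.
  (* Only the index [t] of [extremal] can be interior. *)
  apply/card_le1_eqP => x y; rewrite !inE /extremal.
  have aux (z : 'I_m) : 0 < (if (z < t)%N then lam else
      if z == t :> nat then 1 - t%:R * lam else 0) < lam -> z = t :> nat.
    by case: ifP; rewrite ?ltxx ?andbF // => _; case: eqP; rewrite ?ltxx.
  by move=> /aux xt /aux yt; apply/val_inj; rewrite /= xt yt.
by exists s; apply/funext.
Qed.

Definition transfer (Q : 'I_m -> R) (x y : 'I_m) (u : R) : 'I_m -> R :=
  fun z => Q z + u * ((z == x)%:R - (z == y)%:R).

(** The amount [u] is the largest that respects both bounds: either [x] reaches [lam] or [y] reaches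
    [0], so an interior coordinate is lost and none is gained. *)
Lemma transferP (Q : 'I_m -> R) (x y : 'I_m) : capped_pmf lam Q -> x != y ->
  x \in interior_set Q -> y \in interior_set Q ->
  let u := Num.min (lam - Q x) (Q y) in
  [/\ 0 < u, capped_pmf lam (transfer Q x y u) &
      (#|interior_set (transfer Q x y u)| < #|interior_set Q|)%N].
Proof.
move=> /capped_pmfP[Q0 Q1 Ql] xy xI yI u.
have := xI; have := yI; rewrite !inE => /andP[y0 yl] /andP[x0 xl].
have u0 : 0 < u by rewrite lt_min subr_gt0 xl.
have ux : u <= lam - Q x by rewrite ge_min lexx.
have uy : u <= Q y by rewrite ge_min lexx orbT.
have Tx : transfer Q x y u x = Q x + u.
  by rewrite /transfer eqxx (negPf xy) subr0 mulr1.
have Ty : transfer Q x y u y = Q y - u.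
  by rewrite /transfer eqxx eq_sym (negPf xy) sub0r mulrN1.
have Tz z : z != x -> z != y -> transfer Q x y u z = Q z.
  by rewrite /transfer => /negPf-> /negPf->; rewrite subr0 mulr0 addr0.
split=> //.
  apply/capped_pmfP; split.
  - move=> z; have [->|zx] := eqVneq z x; first by rewrite Tx; lra.
    by have [->|zy] := eqVneq z y; [rewrite Ty; lra|rewrite Tz].
  - rewrite big_split /= Q1 -mulr_sumr sumrB.
    have one (w : 'I_m) : \sum_z (z == w)%:R = 1 :> R.
      by rewrite (bigD1 w) //= eqxx big1 ?addr0 // => z /negPf->.
    by rewrite !one subrr mulr0 addr0.
  - move=> z; have [->|zx] := eqVneq z x; first by rewrite Tx; lra.
    by have [->|zy] := eqVneq z y; [rewrite Ty; lra|rewrite Tz].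
apply: proper_card; apply/properP; split.
  apply/fintype.subsetP => z; have [->|zx] := eqVneq z x => //.
  by have [->|zy] := eqVneq z y => //; rewrite !inE Tz.
have [e|e] : u = lam - Q x \/ u = Q y.
  by rewrite /u; case: leP => _; [left|right].
  by exists x => //; rewrite inE Tx e subrKC ltxx andbF.
by exists y => //; rewrite inE Ty e subrr ltxx.
Qed.

Definition concave (F : ('I_m -> R) -> R) : Prop :=
  forall (Q1 Q2 : 'I_m -> R) (a : R), 0 <= a <= 1 ->
  a * F Q1 + (1 - a) * F Q2 <= F (fun x => a * Q1 x + (1 - a) * Q2 x).

(** Induction on the number of interior coordinates. While two remain, [Q] lies between the two
    opposite transfers along them, and by concavity one of these does not increase [F]. *)
Lemma concave_ge_vertex (F : ('I_m -> R) -> R) (Q : 'I_m -> R) : (0 < m)%N ->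
  concave F -> capped_pmf lam Q ->
  exists s : 'S_m, F (fun x => extremal (s x)) <= F Q.
Proof.
move=> m0 Fc; have [n] := ubnP #|interior_set Q|; elim: n Q => // n IH Q.
rewrite ltnS => In Qc; have [I1|] := leqP #|interior_set Q| 1.
  by have [s ->] := near_vertex_extremal Q m0 Qc I1; exists s.
move=> /card_gt1P[x [y [xI yI xy]]].
have yx : y != x by rewrite eq_sym.
have [] := transferP Q x y Qc xy xI yI.
have [] := transferP Q y x Qc yx yI xI.
set v := Num.min _ _; set u := Num.min _ _ => v0 vc vI u0 uc uI.
have [s1 h1] := IH _ (leq_trans uI In) uc.
have [s2 h2] := IH _ (leq_trans vI In) vc.
(* With this weight [a * u = (1 - a) * v], so the two transfers cancel. *)
pose a := v / (u + v).
have uv : u + v != 0 by rewrite gt_eqF ?addr_gt0.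
have a01 : 0 <= a <= 1.
  by rewrite divr_ge0 ?ler_pdivrMr ?addr_gt0 ?addr_ge0 ?ltW //; lra.
have := Fc (transfer Q x y u) (transfer Q y x v) a a01.
have -> : (fun z => a * transfer Q x y u z + (1 - a) * transfer Q y x v z) = Q.
  apply/funext => z; rewrite /transfer /a; set p := _ - _.
  have -> : (z == y)%:R - (z == x)%:R = - p by rewrite opprB.
  by field.
move: a01 => /andP[a0 a1] h.
have [le12|le21] := leP (F (transfer Q x y u)) (F (transfer Q y x v)).
  by exists s1; apply: le_trans h1 _; apply: le_trans h; nra.
by exists s2; apply: le_trans h2 _; apply: le_trans h; nra.
Qed.

End Vertices.

(** * Sampling without replacement *)

(** The increments of [G] are nondecreasing ([mono]); summing them upwards and downwards from [a]
    keeps [G] above the line through its points at [a] and [a + 1]. *)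
Lemma convex_seq_tangent (R : realType) (m a n : nat) (G : nat -> R) :
  (forall i, (i.+2 <= m)%N -> 0 <= G i.+2 - 2 * G i.+1 + G i) ->
  (a < m)%N -> (n <= m)%N ->
  G a + (G a.+1 - G a) * (n%:R - a%:R) <= G n.
Proof.
move=> cvx am nm.
have mono i d : (i + d < m)%N -> G i.+1 - G i <= G (i + d).+1 - G (i + d)%N.
  elim: d => [|d IH]; first by rewrite addn0.
  rewrite addnS => h; apply: le_trans (IH (ltnW h)) _.
  by have := cvx (i + d)%N h; lra.
have [an|na] := leqP a n.
  have up d : (a + d <= m)%N -> G a + (G a.+1 - G a) * d%:R <= G (a + d)%N.
    elim: d => [|d IH]; first by rewrite addn0 mulr0 addr0.
    rewrite addnS => h; have := IH (ltnW h); have := mono a d h.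
    by rewrite -natr1; lra.
  by rewrite -natrB //; have := up (n - a)%N; rewrite subnKC //; apply.
have down d : (d <= a)%N -> G a - (G a.+1 - G a) * d%:R <= G (a - d)%N.
  elim: d => [|d IH]; first by rewrite subn0 mulr0 subr0.
  move=> h; have := IH (ltnW h).
  have := mono (a - d.+1)%N d.+1; rewrite subnK // => /(_ am).
  by rewrite subnSK // -natr1; lra.
have := down (a - n)%N (leq_subr _ _); rewrite subKn ?(ltnW na) //.
by rewrite natrB ?(ltnW na) //; lra.
Qed.

(* The upper bound is the tangent inequality for the convex sequence
   [C n^2 / 2 - G n]. *)
Lemma seq_le_parabola (R : realType) (m a n : nat) (C : R) (G : nat -> R) :
  (forall i, (i.+2 <= m)%N -> G i.+2 - 2 * G i.+1 + G i <= C) ->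
  (a < m)%N -> (n <= m)%N ->
  G n <= G a + (G a.+1 - G a) * (n%:R - a%:R) +
         C / 2 * ((n%:R - a%:R) * (n%:R - a%:R - 1)).
Proof.
move=> bd am nm.
have cvx i : (i.+2 <= m)%N ->
    0 <= (C / 2 * i.+2%:R ^+ 2 - G i.+2) - 2 * (C / 2 * i.+1%:R ^+ 2 - G i.+1)
         + (C / 2 * i%:R ^+ 2 - G i).
  move=> /bd h; rewrite -!natr1.
  set x := i%:R; rewrite [leRHS](_ : _ = C - (G i.+2 - 2 * G i.+1 + G i)); first lra.
  by field.
have := @convex_seq_tangent R m a n (fun i => C / 2 * i%:R ^+ 2 - G i) cvx am nm.
rewrite -!natr1 -subr_ge0 => h; rewrite -subr_ge0; apply: le_trans h _.
by rewrite le_eqVlt; apply/orP; left; apply/eqP; field.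
Qed.

(** Convexity of the absolute value gives the lower bound. For the upper one, a shift by [u] changes
    an absolute value by at most [u], and two such shifts occur. *)
Lemma abs_second_diff (R : realType) (y u v : R) : 0 <= u -> 0 <= v ->
  0 <= `|y + u + v| - `|y + u| - `|y + v| + `|y| <= 2 * u.
Proof.
move=> u0 v0; apply/andP.
by case: (ger0P (y + u + v)); case: (ger0P (y + u)); case: (ger0P (y + v));
  case: (ger0P y) => *; split; lra.
Qed.

(** * Expected deviations under a uniform random permutation *)

Section Symmetrized.
Context {R : realType} {m : nat} (q : 'I_m -> R) (c : R).

Definition perm_avg (F : 'S_m -> R) : R := m`!%:R^-1 * \sum_s F s.

Lemma perm_avg_cst (x : R) : perm_avg (fun=> x) = x.
Proof.
by rewrite /perm_avg sumr_const card_Sn -[x *+ _]mulr_natl mulKf.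
Qed.

Lemma perm_avgZ (a : R) (F : 'S_m -> R) :
  a * perm_avg F = perm_avg (fun s => a * F s).
Proof. by rewrite /perm_avg mulrCA mulr_sumr. Qed.

Lemma le_perm_avg (F G : 'S_m -> R) : (forall s, F s <= G s) ->
  perm_avg F <= perm_avg G.
Proof.
by move=> FG; rewrite ler_wpM2l ?invr_ge0 ?ler0n // ler_sum.
Qed.

Lemma perm_avg_mull (F : 'S_m -> R) (s : 'S_m) :
  perm_avg (fun r => F (s * r)%g) = perm_avg F.
Proof. by rewrite /perm_avg [in RHS](reindex_inj (mulgI s)). Qed.

(** The function [G] of the overview: the expected deviation from [c] of a sum of [n] draws without
    replacement from the values of [q]. *)
Definition avg_dev (n : nat) : R :=
  perm_avg (fun s => `|\sum_(x < m | (x < n)%N) q (s x) - c|).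

(** A permutation [r] carrying [B] onto the first [#|B|] indices is absorbed by the average. *)
Lemma avg_dev_card (B : {set 'I_m}) :
  perm_avg (fun s => `|\sum_(x in B) q (s x) - c|) = avg_dev #|B|.
Proof.
have [|r rP] := @perm_of_fibers m _ (mem B) (fun x : 'I_m => (x < #|B|)%N).
  have lt1 : #|[pred x : 'I_m | (x < #|B|)%N]| = #|B|.
    have Bm : (#|B| <= m)%N by rewrite -[X in (_ <= X)%N]card_ord max_card.
    rewrite -[LHS]sum1_card -[LHS]/(\sum_(x < m | (x < #|B|)%N) 1%N).
    by rewrite (big_ord_narrow Bm) sum1_card card_ord.
  have [eT eF] : #|[pred x | (x \in B) == true]| = #|B| /\
             #|[pred x : 'I_m | (x < #|B|)%N == true]| = #|B|.
    split; first by apply: eq_card => x; rewrite !inE eqb_id.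
    by rewrite -[RHS]lt1; apply: eq_card => x; rewrite !inE eqb_id.
  case; first by rewrite eT eF.
  have cF (p : pred 'I_m) :
      #|[pred x | p x == false]| = (m - #|[pred x | p x == true]|)%N.
    have -> : #|[pred x | p x == false]| = #|[predC [pred x | p x == true]]|.
      by apply: eq_card => x; rewrite !inE; case: (p x).
    have := cardC [pred x | p x == true]; rewrite card_ord => e.
    by rewrite -[X in (X - _)%N]e addKn.
  by rewrite !cF eT eF.
rewrite -(perm_avg_mull _ r); congr (_ * _); apply: eq_bigr => s _.
congr (`| _ - _ |); rewrite [in RHS](reindex_inj (@perm_inj _ r)) /=.
by apply: eq_big => [x|x _]; [exact: rP | rewrite permM].
Qed.

(** By exchangeability every ordered pair of distinct indices has the same average [h]. Summed over
    all [m * (m - 1)] pairs, with the diagonal added, the product of the total mass [1] and at most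
    [N] indices below [N] bounds the total. *)
Lemma perm_pair_avg (N : nat) (x y : 'I_m) :
  (forall i, 0 <= q i) -> \sum_i q i = 1 -> x != y ->
  perm_avg (fun s => q (s x) * (s y < N)%:R) <= N%:R / (m%:R * (m%:R - 1)).
Proof.
move=> q0 q1 xy; set h := perm_avg _.
have hE i j : i != j -> perm_avg (fun s => q (s i) * (s j < N)%:R) = h.
  (* The first transposition sends [x] to [i]; the second sends the image of [y] to [j] and fixes
     [i]. *)
  move=> ij; set r := (tperm x i * tperm (tperm x i y) j)%g.
  have rx : r x = i.
    rewrite permM tpermL tpermD //; last by rewrite eq_sym.
    by rewrite -{2}(tpermL x i) (inj_eq perm_inj) eq_sym.
  have ry : r y = j by rewrite permM tpermL.
  rewrite /h -(perm_avg_mull (fun s => q (s x) * (s y < N)%:R) r).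
  by congr (_ * _); apply: eq_bigr => s _; rewrite !(permM r s) rx ry.
have m2 : (1 < m)%N.
  rewrite -[m]card_ord; apply/card_gt1P; by exists x, y.
have mm : 0 < m%:R * (m%:R - 1) :> R.
  by rewrite mulr_gt0 ?subr_gt0 ?ltr1n // ltr0n ltnW.
rewrite ler_pdivlMr //.
have -> : h * (m%:R * (m%:R - 1)) = \sum_(i < m) \sum_(j < m | j != i) h.
  under eq_bigr => i _ do rewrite sumr_const cardC1 card_ord.
  rewrite sumr_const card_ord -mulrnA -[RHS]mulr_natr natrM -subn1.
  by rewrite natrB ?(ltnW m2) // [_ * m%:R]mulrC.
apply: (@le_trans _ _ (\sum_(i < m) \sum_(j < m)
    perm_avg (fun s => q (s i) * (s j < N)%:R))).
  apply: ler_sum => i _; rewrite [leRHS](bigD1 i) //= -[leLHS]add0r lerD //.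
    rewrite mulr_ge0 ?invr_ge0 ?ler0n // sumr_ge0 // => s _.
    by rewrite mulr_ge0 ?ler0n.
  by apply: ler_sum => j ji; rewrite hE // eq_sym.
under eq_bigr => i _ do rewrite -mulr_sumr exchange_big.
rewrite -mulr_sumr exchange_big /= -/(perm_avg _) -[leRHS](perm_avg_cst).
apply: le_perm_avg => s; under eq_bigr => i _ do rewrite -mulr_sumr.
rewrite -mulr_suml -(reindex_inj (@perm_inj _ s) (P := xpredT)) q1 mul1r.
rewrite -(reindex_inj (@perm_inj _ s) (P := xpredT) (F := fun j : 'I_m => (j < N)%:R)) /=.
have [Nm|mN] := leqP N m.
  rewrite (eq_bigr (fun j : 'I_m => if (j < N)%N then 1 else 0)); last first.
    by move=> j _; case: ifP.
  by rewrite -big_mkcond (big_ord_narrow Nm) sumr_const card_ord.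
apply: (@le_trans _ _ (\sum_(j < m) 1)).
  by apply: ler_sum => j _; case: (j < N)%N; rewrite ?ler01.
by rewrite sumr_const card_ord ler_nat ltnW.
Qed.

(** With [i] and [j] the next two positions, the second difference is the average of the mixed
    difference in [abs_second_diff] for the increments [q (s i)] and [q (s j)]. *)
Lemma avg_dev_second_diff (N n : nat) : (forall i, 0 <= q i) ->
  \sum_i q i = 1 -> (forall i : 'I_m, (N <= i)%N -> q i = 0) ->
  (n.+2 <= m)%N ->
  0 <= avg_dev n.+2 - 2 * avg_dev n.+1 + avg_dev n <= 4 * N%:R / m%:R ^+ 2.
Proof.
move=> q0 q1 qN nm.
pose i : 'I_m := Ordinal (ltnW nm); pose j : 'I_m := Ordinal nm.
have ij : i != j by rewrite -val_eqE /= neq_ltn ltnSn.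
pose S (s : 'S_m) := \sum_(x < m | (x < n)%N) q (s x).
have S1 (s : 'S_m) : \sum_(x < m | (x < n.+1)%N) q (s x) = S s + q (s i).
  rewrite (bigD1 i) //= addrC; congr (_ + _); apply: eq_bigl => x.
  by rewrite -val_eqE /= ltnS [RHS]ltn_neqAle andbC.
have S2 (s : 'S_m) : \sum_(x < m | (x < n.+2)%N) q (s x) = S s + q (s i) + q (s j).
  rewrite -S1 (bigD1 j) //= addrC; congr (_ + _); apply: eq_bigl => x.
  by rewrite -val_eqE /= ltnS [RHS]ltn_neqAle andbC.
have e2 : avg_dev n.+2 = perm_avg (fun s => `|S s - c + q (s i) + q (s j)|).
  by congr (_ * _); apply: eq_bigr => s _; rewrite S2; congr `|_|; ring.
have e1 : avg_dev n.+1 = perm_avg (fun s => `|S s - c + q (s i)|).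
  by congr (_ * _); apply: eq_bigr => s _; rewrite S1; congr `|_|; ring.
(* Exchanging [i] and [j] lets the two copies of [avg_dev n.+1] add different draws. *)
have e1' : avg_dev n.+1 = perm_avg (fun s => `|S s - c + q (s j)|).
  rewrite e1 -(perm_avg_mull _ (tperm i j)); congr (_ * _).
  apply: eq_bigr => s _; rewrite permM tpermL; congr (`|_ - _ + _|).
  apply: eq_bigr => x xn; rewrite permM tpermD //; rewrite -val_eqE /= gtn_eqF //.
  exact: ltnW.
have -> : avg_dev n.+2 - 2 * avg_dev n.+1 + avg_dev n =
   perm_avg (fun s => `|S s - c + q (s i) + q (s j)| - `|S s - c + q (s i)|
                      - `|S s - c + q (s j)| + `|S s - c|).
  rewrite mulr2n mulrDl !mul1r {1}e1 e1' e2 /avg_dev /perm_avg.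
  by rewrite big_split !sumrB /=; ring.
have m0 : 0 < m%:R - 1 :> R by rewrite subr_gt0 ltr1n (leq_trans _ nm).
apply/andP; split.
  rewrite -[leLHS](perm_avg_cst); apply: le_perm_avg => s.
  by have /andP[] := abs_second_diff R (S s - c) (q (s i)) (q (s j)) (q0 _) (q0 _).
(* If [s j >= N] then [q (s j) = 0] and the mixed difference vanishes. *)
apply: (@le_trans _ _ (2 * perm_avg (fun s => q (s i) * (s j < N)%:R))).
  rewrite perm_avgZ; apply: le_perm_avg => s.
  case: ltnP => jN; last by rewrite (qN _ jN) mulr0 !addr0; lra.
  rewrite mulr1.
  by have /andP[] := abs_second_diff R (S s - c) (q (s i)) (q (s j)) (q0 _) (q0 _).
apply: (@le_trans _ _ (2 * (N%:R / (m%:R * (m%:R - 1))))).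
  by rewrite ler_pM2l ?ltr0n // perm_pair_avg.
(* For [m >= 2], [2 / (m * (m - 1)) <= 4 / m^2]; this is the source of the constant [4]. *)
have m2 : 2 <= m%:R :> R by rewrite ler_nat (leq_trans _ nm).
rewrite mulrA ler_pdivrMr ?mulr_gt0 //; last lra.
rewrite mulrAC ler_pdivlMr ?exprn_gt0 //; last lra.
have h : 0 <= N%:R * (m%:R * (m%:R - 2)) :> R.
  by rewrite !mulr_ge0 ?ler0n ?subr_ge0.
rewrite -subr_ge0; apply: le_trans (mulr_ge0 (ler0n _ 2) h) _.
by rewrite le_eqVlt; apply/orP; left; apply/eqP; ring.
Qed.

End Symmetrized.

(** * Independent uniform labels *)

Lemma prod_natr_bool (R : comPzRingType) (I : finType) (P : pred I) :
  \prod_i (P i)%:R = [forall i, P i]%:R :> R.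
Proof.
have [/forallP h|] := boolP [forall i, P i].
  by rewrite big1 // => i _; rewrite h.
by case/forallPn => i /negPf h; rewrite (bigD1 i) //= h mul0r.
Qed.

Section UniformLabels.
Context {R : realType} {k m : nat} (k0 : (0 < k)%N).
Local Notation labels := {ffun 'I_m -> 'I_k}.
Local Notation p := (k%:R^-1 : R).

Lemma natr_k_neq0 : k%:R != 0 :> R.
Proof. by rewrite pnatr_eq0 -lt0n. Qed.

Definition label_avg (F : labels -> R) : R := (k%:R ^+ m)^-1 * \sum_b F b.

Definition label_class (b : labels) (s : 'I_k) : {set 'I_m} :=
  finset (fun x => b x == s).

Lemma label_avg_sum (I : finType) (P : pred I) (F : I -> labels -> R) :
  label_avg (fun b => \sum_(i | P i) F i b) = \sum_(i | P i) label_avg (F i).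
Proof. by rewrite /label_avg exchange_big mulr_sumr. Qed.

Lemma label_avgZ (a : R) (F : labels -> R) :
  label_avg (fun b => a * F b) = a * label_avg F.
Proof. by rewrite /label_avg -mulr_sumr mulrCA. Qed.

Lemma label_avgD (F G : labels -> R) :
  label_avg (fun b => F b + G b) = label_avg F + label_avg G.
Proof. by rewrite /label_avg big_split mulrDr. Qed.

Lemma label_avg_cst (a : R) : label_avg (fun=> a) = a.
Proof.
rewrite /label_avg sumr_const card_ffun !card_ord -[a *+ _]mulr_natl natrX.
by rewrite mulKf // expf_neq0 // natr_k_neq0.
Qed.

Lemma le_label_avg (F G : labels -> R) : (forall b, F b <= G b) ->
  label_avg F <= label_avg G.
Proof.
by move=> FG; rewrite ler_wpM2l ?invr_ge0 ?exprn_ge0 ?ler0n // ler_sum.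
Qed.

(** Independence of the labels of distinct tokens. *)
Lemma label_avg_prod (f : 'I_m -> 'I_k -> R) :
  label_avg (fun b => \prod_x f x (b x)) = \prod_x (p * \sum_y f x y).
Proof.
by rewrite big_split /= prodr_const card_ord bigA_distr_bigA /= exprVn.
Qed.

(** The event factors over tokens: those of [A] get label [s], those of [D :\: A] another label, and
    the rest are free. *)
Lemma prob_class_inter (D A : {set 'I_m}) (s : 'I_k) : A \subset D ->
  label_avg (fun b => (D :&: label_class b s == A)%:R) =
  p ^+ #|A| * (1 - p) ^+ (#|D| - #|A|).
Proof.
move=> AD.
pose P x y := (x \in D) ==> ((y == s) == (x \in A)).
transitivity (label_avg (fun b => \prod_x (P x (b x))%:R)).
  congr (_ * _); apply: eq_bigr => b _; rewrite prod_natr_bool.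
  congr ((nat_of_bool _)%:R).
  apply/idP/idP => [/eqP e|/fintype.forallP h].
    apply/fintype.forallP => x.
    by rewrite /P -e !inE; case: (x \in D) => //=; rewrite eqxx.
  apply/eqP/setP => x; have := h x; rewrite /P !inE.
  case xD: (x \in D) => /=; first by move/eqP.
  by move=> _; apply/esym/negP => /(fintype.subsetP AD); rewrite xD.
rewrite (label_avg_prod (fun x y => (P x y)%:R)).
transitivity (\prod_x ((if x \in A then p else 1) *
                       (if x \in D :\: A then 1 - p else 1))).
  apply: eq_bigr => x _; rewrite /P !inE.
  have sum1 : \sum_(y < k) (y == s)%:R = 1 :> R.
    by rewrite (bigD1 s) //= eqxx big1 ?addr0 // => y /negPf->.
  have sumk : \sum_(y < k) 1 = k%:R :> R by rewrite sumr_const card_ord.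
  case xD: (x \in D) => /=; case xA: (x \in A) => /=; rewrite ?mul1r ?mulr1.
  - by under eq_bigr do rewrite eqb_id; rewrite sum1 mulr1.
  - have -> : \sum_(y < k) ((y == s) == false)%:R = k%:R - 1 :> R.
      by rewrite -sumk -[X in _ - X]sum1 -sumrB; apply: eq_bigr => y _;
        case: (y == s); rewrite ?subrr ?subr0.
    by rewrite mulrBr mulr1 mulVf ?natr_k_neq0.
  - by move/(fintype.subsetP AD): xA; rewrite xD.
  - by rewrite sumk mulVf ?natr_k_neq0.
rewrite big_split /= -!big_mkcond /= !prodr_const.
by rewrite cardsD (finset.setIidPr AD).
Qed.

Lemma label_avg_class_inter (D : {set 'I_m}) (s : 'I_k) (F : labels -> R) :
  label_avg F =
  \sum_(A : {set 'I_m} | A \subset D)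
     label_avg (fun b => (D :&: label_class b s == A)%:R * F b).
Proof.
rewrite -label_avg_sum; congr (_ * _); apply: eq_bigr => b _.
rewrite (bigD1 (D :&: label_class b s)) ?finset.subsetIl //= eqxx mul1r.
rewrite big1 ?addr0 // => A.
by case/andP => _; rewrite eq_sym => /negPf->; rewrite mul0r.
Qed.

Lemma sum_subsets_card (D : {set 'I_m}) (g : nat -> R) :
  \sum_(A : {set 'I_m} | A \subset D) g #|A| =
  \sum_(0 <= c < #|D|.+1) g c *+ 'C(#|D|, c).
Proof.
rewrite big_mkord.
rewrite (partition_big (fun A : {set 'I_m} => inord #|A| : 'I_(#|D|.+1)) xpredT) //=.
apply: eq_bigr => c _; rewrite -cards_draws -sumr_const.
apply: eq_big => [A|A /andP[AD /eqP<-]]; last first.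
  by rewrite inordK // ltnS subset_leq_card.
rewrite inE; case AD: (A \subset D) => //=.
by rewrite -val_eqE /= inordK // ltnS subset_leq_card.
Qed.

(** Conditioning on which tokens of [D] have label [s] and grouping these sets by size produces the
    binomial weights. *)
Lemma label_avg_binomial (D : {set 'I_m}) (s : 'I_k) (g : nat -> R) :
  label_avg (fun b => g #|D :&: label_class b s|) =
  \sum_(0 <= c < #|D|.+1) binomial_pmf #|D| p c * g c.
Proof.
rewrite (label_avg_class_inter D s).
rewrite (eq_bigr (fun A : {set 'I_m} =>
    g #|A| * (p ^+ #|A| * (1 - p) ^+ (#|D| - #|A|)))); last first.
  move=> A AD; rewrite -(prob_class_inter D A s AD) -label_avgZ.
  by congr (_ * _); apply: eq_bigr => b _; case: eqP => [<-|_];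
    rewrite ?mul0r ?mulr0 // mulrC.
rewrite (sum_subsets_card D (fun c => g c * (p ^+ c * (1 - p) ^+ (#|D| - c)))).
by apply: eq_bigr => c _; rewrite /binomial_pmf /unstable.onem mulrnAl mulrC.
Qed.

(** The label of [x0] is independent of the labels on [D]; this serves the token that carries the
    remainder. *)
Lemma label_avg_binomial2 (D : {set 'I_m}) (x0 : 'I_m) (s : 'I_k)
    (g : nat -> bool -> R) : x0 \notin D ->
  label_avg (fun b => g #|D :&: label_class b s| (b x0 == s)) =
  \sum_(0 <= c < #|D|.+1) binomial_pmf #|D| p c *
     (p * g c true + (1 - p) * g c false).
Proof.
move=> x0D; rewrite (label_avg_class_inter D s).
pose w c := p ^+ c * (1 - p) ^+ (#|D| - c) * (p * g c true + (1 - p) * g c false).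
rewrite (eq_bigr (fun A : {set 'I_m} => w #|A|)); last first.
  move=> A AD.
  have x0A : x0 \notin A by apply: contra x0D; apply/fintype.subsetP.
  have cD : #|x0 |: D| = #|D|.+1 by rewrite cardsU1 x0D.
  have cA : #|x0 |: A| = #|A|.+1 by rewrite cardsU1 x0A.
  (* The joint law is read off on [x0 |: D]: the trace there is [A] or [x0 |: A] according to the
     label of [x0]. *)
  have := prob_class_inter (x0 |: D) A s (fintype.subset_trans AD (finset.subsetUr _ _)).
  have := prob_class_inter (x0 |: D) (x0 |: A) s (finset.setUS _ AD).
  rewrite cD cA subSS subSn ?subset_leq_card // => p1 p2.
  rewrite /w mulrDr.
  transitivity (g #|A| true * (p ^+ #|A|.+1 * (1 - p) ^+ (#|D| - #|A|)) +
     g #|A| false * (p ^+ #|A| * (1 - p) ^+ (#|D| - #|A|).+1)); last first.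
    by rewrite !exprS; ring.
  rewrite -p1 -p2 -!label_avgZ -label_avgD; congr (_ * _); apply: eq_bigr => b _.
  have I1 : (x0 |: D) :&: label_class b s =
    if b x0 == s then x0 |: (D :&: label_class b s) else D :&: label_class b s.
    apply/setP => x; case: ifP => bx; rewrite !inE;
      by have [->|] := eqVneq x x0; rewrite ?bx ?(negPf x0D).
  rewrite I1; case: ifP => bx.
    have -> : (x0 |: D :&: label_class b s == x0 |: A) = (D :&: label_class b s == A).
      apply/eqP/eqP => [e|->] //; apply/setP => x.
      have := congr1 (fun B : {set 'I_m} => x \in B) e.
      by rewrite /= !inE; have [->|] := eqVneq x x0; rewrite ?(negPf x0D) ?(negPf x0A).
    have -> : (x0 |: D :&: label_class b s == A) = false.
      by apply/eqP => e; move: x0A; rewrite -e finset.setU11.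
    by rewrite mulr0 addr0; case: eqP => [<-|]; rewrite ?mul0r ?mulr0 // mulrC.
  have -> : (D :&: label_class b s == x0 |: A) = false.
    apply/eqP => e; have := finset.setU11 x0 A; rewrite -e inE (negPf x0D).
    by [].
  by rewrite mulr0 add0r; case: eqP => [<-|]; rewrite ?mul0r ?mulr0 // mulrC.
rewrite (sum_subsets_card D w).
by apply: eq_bigr => c _; rewrite /binomial_pmf /unstable.onem /w mulrnAl.
Qed.

Lemma sum_card_class (b : labels) : \sum_s #|label_class b s|%:R = m%:R :> R.
Proof.
rewrite -natr_sum -[in RHS](card_ord m) -[in RHS]sum1_card.
rewrite (partition_big b xpredT) //=; congr (_%:R); apply: eq_bigr => s _.
by rewrite -sum1_card; apply: eq_bigl => x; rewrite inE.
Qed.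

(** A squared class size counts ordered pairs in the class. The pair [x], [y] lies in it with
    probability [p ^+ #|[set x; y]|], that is [p] on the diagonal and [p ^+ 2] off it. *)
Lemma label_avg_card_sqr : (0 < m)%N ->
  label_avg (fun b => \sum_s #|label_class b s|%:R ^+ 2) = m%:R + m%:R * (m%:R - 1) * p.
Proof.
move=> m0; rewrite label_avg_sum.
rewrite (eq_bigr (fun=> m%:R * p + m%:R * (m%:R - 1) * p ^+ 2)); last first.
  move=> s _.
  have pr (D : {set 'I_m}) :
      label_avg (fun b => (D \subset label_class b s)%:R) = p ^+ #|D|.
    have := prob_class_inter D D s (fintype.subxx _); rewrite subnn mulr1 => <-.
    congr (_ * _); apply: eq_bigr => b _.
    by rewrite (sameP eqP finset.setIidPl).
  transitivity (\sum_x \sum_y label_avg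
      (fun b => (([set x; y] : {set 'I_m})%SET \subset label_class b s)%:R)).
    under [RHS]eq_bigr do rewrite -label_avg_sum.
    rewrite -label_avg_sum; congr (_ * _); apply: eq_bigr => b _.
    have -> : #|label_class b s|%:R = \sum_x (b x == s)%:R :> R.
      rewrite -sum1_card natr_sum big_mkcond; apply: eq_bigr => x _.
      by rewrite inE; case: (_ == _).
    rewrite expr2 mulr_suml; apply: eq_bigr => x _; rewrite mulr_sumr.
    apply: eq_bigr => y _; rewrite finset.subUset !finset.sub1set !inE.
    by rewrite -natrM mulnb.
  transitivity (\sum_(x < m) (p + (m%:R - 1) * p ^+ 2)); last first.
    by rewrite sumr_const card_ord -[LHS]mulr_natl; ring.
  apply: eq_bigr => x _; rewrite (bigD1 x) //= pr finset.setUid cards1 expr1.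
  congr (_ + _); under eq_bigr => y yx.
    rewrite pr cards2 eq_sym yx; over.
  by rewrite sumr_const cardC1 card_ord -[LHS]mulr_natl -subn1 natrB.
rewrite sumr_const card_ord -[LHS]mulr_natl.
by field; exact: natr_k_neq0.
Qed.

End UniformLabels.

(** * The max-min value *)

(* Tangent and parabola are taken at [a = (m - 1) %/ k], so that the mean
   class size [m / k] lies in [[a, a + 1]]; the variance of a class size is at
   most [m / k]. *)
Lemma label_avg_le_class_sum (R : realType) (k m : nat) (C : R) (G : nat -> R)
    (b : {ffun 'I_m -> 'I_k}) : (0 < k)%N -> (0 < m)%N -> 0 <= C ->
  (forall n, (n.+2 <= m)%N -> 0 <= G n.+2 - 2 * G n.+1 + G n <= C) ->
  label_avg (fun b' : {ffun 'I_m -> 'I_k} => \sum_s G #|label_class b' s|) <=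
  \sum_s G #|label_class b s| + C / 2 * m%:R.
Proof.
move=> k0 m0 C0 hG; set a := (m.-1 %/ k)%N.
(* The predecessor matters: for [k = 1], [m %/ k] would equal [m] and [G a.+1] would leave the
   range. *)
have am : (a < m)%N by rewrite (leq_ltn_trans (leq_div _ _)) // prednK.
have cm b' s : (#|@label_class k m b' s| <= m)%N by rewrite -[leqRHS]card_ord max_card.
have ksum (x : R) : k%:R * x = \sum_(s < k) x.
  by rewrite sumr_const card_ord mulr_natl.
(* The class sizes sum to [m], so the summed tangent does not depend on [b]. *)
have lo : k%:R * G a + (G a.+1 - G a) * (m%:R - k%:R * a%:R) <=
    \sum_s G #|label_class b s|.
  rewrite -(sum_card_class b) !ksum -sumrB mulr_sumr -big_split /=; apply: ler_sum => s _.
  by apply: (convex_seq_tangent R m) => // i /hG/andP[].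
have up : label_avg (fun b' : {ffun 'I_m -> 'I_k} => \sum_s G #|label_class b' s|) <=
  label_avg (fun b' : {ffun 'I_m -> 'I_k} =>
    (k%:R * (G a - (G a.+1 - G a) * a%:R + C / 2 * (a%:R * (a%:R + 1))) +
     ((G a.+1 - G a) - C / 2 * (2 * a%:R + 1)) * m%:R) +
    C / 2 * \sum_s #|label_class b' s|%:R ^+ 2).
  apply: le_label_avg => b'; rewrite -(sum_card_class b') ksum.
  rewrite !mulr_sumr -!big_split /=; apply: ler_sum => s _.
  have := @seq_le_parabola R m a #|label_class b' s| C G _ am (cm b' s).
  have hC i : (i.+2 <= m)%N -> G i.+2 - 2 * G i.+1 + G i <= C by move=> /hG/andP[].
  move=> /(_ hC) h; rewrite -subr_ge0 in h; rewrite -subr_ge0; apply: le_trans h _.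
  by rewrite le_eqVlt; apply/orP; left; apply/eqP; field.
rewrite label_avgD label_avgZ label_avg_cst // label_avg_card_sqr // in up.
apply: le_trans up _; rewrite -lerBlDr; apply: le_trans lo; rewrite lerBlDr.
have k0' : 0 < k%:R :> R by rewrite ltr0n.
have ka : k%:R * a%:R <= m%:R :> R.
  by rewrite -natrM ler_nat mulnC (leq_trans (leq_trunc_div _ _)) // leq_pred.
have ka1 : m%:R <= k%:R * (a%:R + 1) :> R.
  by rewrite natr1 -natrM ler_nat mulnC -(prednK m0) ltn_ceil.
(* This is exactly the slack left in the goal; it is nonnegative since
   [k * a <= m <= k * (a + 1)]. *)
have key : 0 <= C / 2 * (m%:R / k%:R +
    (m%:R - k%:R * a%:R) * (k%:R * (a%:R + 1) - m%:R) / k%:R).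
  rewrite mulr_ge0 ?divr_ge0 // addr_ge0 ?divr_ge0 ?mulr_ge0 ?subr_ge0 //.
rewrite -subr_ge0; apply: le_trans key _.
by rewrite le_eqVlt; apply/orP; left; apply/eqP; field; rewrite gt_eqF.
Qed.

Section MaxMin.
Context {R : realType} {k m : nat} (lam : R) (cpl : coupling_rule R k m).
Hypotheses (k0 : (0 < k)%N) (m0 : (0 < m)%N) (lam0 : 0 < lam).
Hypotheses (hm : m%:R^-1 <= lam) (hcpl : maximal_rule cpl).
Local Notation t := (Num.truncn lam^-1).
Local Notation labels := {ffun 'I_m -> 'I_k}.
Local Notation p := (k%:R^-1 : R).

Local Notation q := (@extremal R m lam).

Definition vertex (s : 'S_m) : 'I_m -> R := fun x => extremal lam (s x).

Lemma capped_vertex s : capped_pmf lam (vertex s).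
Proof. exact/capped_perm/capped_extremal. Qed.

(* Coupling rules are unconstrained off the probability vectors, so concavity
   on all of ['I_m -> R] holds for this formula only. *)
Definition concave_Rd (Q : 'I_m -> R) (b : labels) : R :=
  1 - (2 * k%:R)^-1 - 4^-1 * \sum_s `|P_Y Q b s - p|.

Lemma capped_RdE (Q : 'I_m -> R) (b : labels) : capped_pmf lam Q ->
  Rd cpl Q b = concave_Rd Q b.
Proof. by move=> [Qp _]; apply: RdE. Qed.

Lemma concave_ERd (P : labels -> R) : (forall b, 0 <= P b) ->
  concave (fun Q => \sum_b P b * concave_Rd Q b).
Proof.
move=> P0 Q1 Q2 a /andP[a0 a1]; rewrite !mulr_sumr -big_split /=.
apply: ler_sum => b _.
have -> : a * (P b * concave_Rd Q1 b) + (1 - a) * (P b * concave_Rd Q2 b) =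
   P b * (a * concave_Rd Q1 b + (1 - a) * concave_Rd Q2 b) by ring.
rewrite ler_wpM2l // /concave_Rd.
set S := \sum_s _; set S1 := \sum_s _; set S2 := \sum_s _.
suff : S2 <= a * S + (1 - a) * S1 by nra.
rewrite !mulr_sumr -big_split /=; apply: ler_sum => s _.
have -> : P_Y (fun x => a * Q1 x + (1 - a) * Q2 x) b s - p =
   a * (P_Y Q1 b s - p) + (1 - a) * (P_Y Q2 b s - p).
  by rewrite /P_Y big_split /= -!mulr_sumr; ring.
apply: le_trans (ler_normD _ _) _; rewrite !normrM.
by rewrite (ger0_norm a0) [`|1 - a|]ger0_norm ?subr_ge0.
Qed.

(** Concavity sends every [Q] to some vertex that is no better, and the finitely many vertices have
    a minimiser. *)
Lemma vertex_min (P : labels -> R) : is_pmf P ->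
  exists s, forall Q, capped_pmf lam Q -> ERd cpl P (vertex s) <= ERd cpl P Q.
Proof.
move=> [P0 P1].
case: (@Order.TotalTheory.arg_minP _ _ _ (1%g : 'S_m) xpredT
        (fun s => ERd cpl P (vertex s))) => // s _ smin.
have E Q : capped_pmf lam Q -> ERd cpl P Q = \sum_b P b * concave_Rd Q b.
  by move=> Qc; apply: eq_bigr => b _; rewrite capped_RdE.
exists s => Q Qc.
have [r hr] := concave_ge_vertex lam lam0 hm _ Q m0 (concave_ERd P P0) Qc.
apply: le_trans (smin r isT) _; rewrite (E Q) // E //; exact: capped_vertex.
Qed.

Lemma inf_payoffs (P : labels -> R) : is_pmf P ->
  [/\ payoffs cpl lam P (inf (payoffs cpl lam P)),
      lbound (payoffs cpl lam P) (inf (payoffs cpl lam P)) &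
      exists s, inf (payoffs cpl lam P) = ERd cpl P (vertex s)].
Proof.
move=> Pp; have [s smin] := vertex_min P Pp.
have in_s : payoffs cpl lam P (ERd cpl P (vertex s)).
  by exists (vertex s) => //; exact: capped_vertex.
have lb_s : lbound (payoffs cpl lam P) (ERd cpl P (vertex s)).
  by move=> _ [Q Qc <-]; apply: smin.
have e : inf (payoffs cpl lam P) = ERd cpl P (vertex s).
  apply/eqP; rewrite eq_le; apply/andP; split.
    by apply: ge_inf => //; exists (ERd cpl P (vertex s)).
  by apply: lb_le_inf => //; exists (ERd cpl P (vertex s)).
by rewrite e; split=> //; exists s.
Qed.

(** The function [V] of the overview: the payoff of [b] against a uniformly random vertex. *)
Definition type_value (b : labels) : R :=
  perm_avg (fun s => Rd cpl (vertex s) b).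

(** The infimum is at most the average over all vertices, which is the [P]-mixture of the values
    [type_value b]. *)
Lemma inf_payoffs_le (P : labels -> R) (v : R) : is_pmf P ->
  (forall b, type_value b <= v) -> inf (payoffs cpl lam P) <= v.
Proof.
move=> Pp hv; have [_ lb _] := inf_payoffs P Pp; have [P0 P1] := Pp.
apply: (@le_trans _ _ (perm_avg (fun s => ERd cpl P (vertex s)))).
  rewrite -[leLHS](@perm_avg_cst R m); apply: le_perm_avg => s.
  by apply: lb; exists (vertex s) => //; exact: capped_vertex.
have -> : perm_avg (fun s => ERd cpl P (vertex s)) = \sum_b P b * type_value b.
  rewrite /perm_avg exchange_big mulr_sumr /=; apply: eq_bigr => b _.
  by rewrite -mulr_sumr mulrCA.
rewrite -[v]mul1r -P1 mulr_suml; apply: ler_sum => b _.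
by rewrite ler_wpM2l.
Qed.

Definition relabel (b : labels) (s : 'S_m) : labels := [ffun x => b (s x)].

Lemma Rd_relabel (b : labels) (r s : 'S_m) :
  Rd cpl (vertex r) (relabel b s) = Rd cpl (vertex (s^-1 * r)%g) b.
Proof.
rewrite !capped_RdE; try exact: capped_vertex.
congr (_ - _ * _); apply: eq_bigr => y _; congr (`|_ - _|); rewrite /P_Y.
rewrite (reindex_inj (@perm_inj _ s^-1%g)); apply: eq_big => x.
  by rewrite ffunE permKV.
by move=> _; rewrite /vertex permM.
Qed.

(** The law of [b] with its tokens uniformly shuffled. *)
Definition exchangeable_pmf (b : labels) : labels -> R :=
  fun b' => perm_avg (fun s : 'S_m => (b' == relabel b s)%:R).

Lemma is_pmf_exchangeable (b : labels) : is_pmf (exchangeable_pmf b).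
Proof.
split=> [b'|].
  by rewrite -[leLHS](@perm_avg_cst R m); apply: le_perm_avg => s; rewrite ler0n.
rewrite -mulr_sumr exchange_big /= -[RHS](@perm_avg_cst R m); congr (_ * _).
apply: eq_bigr => s _; rewrite (bigD1 (relabel b s)) //= eqxx big1 ?addr0 //.
by move=> b' /negPf->.
Qed.

(** The infimum sits at some vertex [r]. Shuffling the labels amounts to shuffling the vertex, and
    the substitution of [s^-1 * r] for [s] removes the dependence on [r]. *)
Lemma inf_payoffs_exchangeable (b : labels) :
  inf (payoffs cpl lam (exchangeable_pmf b)) = type_value b.
Proof.
have [_ _ [r ->]] := inf_payoffs _ (is_pmf_exchangeable b).
rewrite /ERd /exchangeable_pmf /perm_avg.
under eq_bigr => b' _ do rewrite -mulrA mulr_suml.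
rewrite -mulr_sumr exchange_big /= /type_value; congr (_ * _).
rewrite [RHS](reindex_inj (mulIg r)) [RHS](reindex_inj invg_inj).
apply: eq_bigr => s _; rewrite (bigD1 (relabel b s)) //= eqxx mul1r.
rewrite big1 ?addr0 ?Rd_relabel // => b' /negPf->; exact: mul0r.
Qed.

(** For a maximiser [b] of [type_value], its shuffled law attains [type_value b], and
    [inf_payoffs_le] shows that no law does better. *)
Lemma Rd_starP : exists b : labels,
  [/\ max_min_attained cpl lam, Rd_star cpl lam = type_value b &
      forall b', type_value b' <= type_value b].
Proof.
have b0 : labels := [ffun=> Ordinal k0].
case: (@Order.TotalTheory.arg_maxP _ _ _ b0 xpredT type_value) => // b _ bmax.
have in_b : worst_cases cpl lam (type_value b).
  exists (exchangeable_pmf b); first exact: is_pmf_exchangeable.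
  exact: inf_payoffs_exchangeable.
have ub_b : ubound (worst_cases cpl lam) (type_value b).
  by move=> _ [P Pp <-]; apply: inf_payoffs_le => // b'; apply: bmax.
have e : Rd_star cpl lam = type_value b.
  apply/eqP; rewrite eq_le; apply/andP; split.
    by apply: ge_sup => //; exists (type_value b).
  by apply: ub_le_sup => //; exists (type_value b).
exists b; split=> // [|b']; last exact: bmax.
split=> [P Pp|]; last by rewrite e.
by have [] := inf_payoffs P Pp.
Qed.

Lemma type_valueE (b : labels) : type_value b = 1 - (2 * k%:R)^-1 -
  4^-1 * \sum_s avg_dev q p #|label_class b s|.
Proof.
rewrite /type_value -[in RHS](@perm_avg_cst R m (1 - _)) /perm_avg.
under eq_bigr => s _ do rewrite (capped_RdE _ _ (capped_vertex s)).
rewrite /concave_Rd sumrB mulrBr; congr (_ - _).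
rewrite -mulr_sumr mulrCA exchange_big mulr_sumr /=; congr (_ * _).
apply: eq_bigr => y _; rewrite -avg_dev_card; congr (_ * _).
apply: eq_bigr => s _; congr (`|_ - _|); apply: eq_bigl => x.
by rewrite inE.
Qed.

(** The number of the [t] tokens of mass [lam] with label [y] is binomial, and the remainder token
    independently has label [y] with probability [p]. *)
Lemma label_avg_vertex_dev (s : 'S_m) (y : 'I_k) :
  label_avg (fun b => `|P_Y (vertex s) b y - p|) =
  \sum_(0 <= c < t.+1) binomial_pmf t p c *
    (p * `|c%:R * lam + (1 - t%:R * lam) - p| + (1 - p) * `|c%:R * lam - p|).
Proof.
pose D : {set 'I_m} := finset (fun x => (s x < t)%N).
have tm := truncn_le_card lam lam0 hm m0.
have cD : #|D| = t.
  transitivity (\sum_(x < m | (x < t)%N) 1%N).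
    rewrite -sum1_card [RHS](reindex_inj (@perm_inj _ s)).
    by apply: eq_bigl => x; rewrite inE.
  by rewrite (big_ord_narrow tm) sum1_card card_ord.
have PY b : P_Y (vertex s) b y = #|D :&: label_class b y|%:R * lam +
    \sum_(x | s x == t :> nat) (b x == y)%:R * (1 - t%:R * lam).
  rewrite /P_Y mulr_natl -sumr_const big_mkcond.
  rewrite [X in _ = X + _]big_mkcond [X in _ = _ + X]big_mkcond -big_split /=.
  apply: eq_bigr => x _; rewrite /vertex /extremal !inE.
  by case: ltngtP => _; case: (b x == y); rewrite /= ?addr0 ?add0r ?mul1r ?mul0r.
(* If [t = m] there is no remainder token, and both absolute values coincide because the remainder
   is [0]. *)
have [mt|mt] := ltnP t m; last first.
  have r0 := remainder_eq0 lam lam0 hm m0 mt.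
  transitivity (label_avg (fun b => `|#|D :&: label_class b y|%:R * lam - p|)).
    congr (_ * _); apply: eq_bigr => b _; rewrite PY big1 ?addr0 // => x _.
    by rewrite r0 mulr0.
  rewrite (label_avg_binomial k0 D y (fun c => `|c%:R * lam - p|)) cD.
  by apply: eq_bigr => c _; rewrite r0 addr0; ring.
pose x0 := (s^-1)%g (Ordinal mt).
have x0D : x0 \notin D by rewrite inE permKV /= ltnn.
transitivity (label_avg (fun b => (fun (c : nat) (e : bool) =>
   `|c%:R * lam + e%:R * (1 - t%:R * lam) - p|) #|D :&: label_class b y| (b x0 == y))).
  congr (_ * _); apply: eq_bigr => b _; rewrite PY (big_pred1 x0) // => x /=.
  by rewrite -(inj_eq (@perm_inj _ s)) permKV -val_eqE.
rewrite (label_avg_binomial2 k0 D x0 y (fun (c : nat) (e : bool) =>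
   `|c%:R * lam + e%:R * (1 - t%:R * lam) - p|)) // cD.
by apply: eq_bigr => c _; rewrite mul1r mul0r addr0.
Qed.

(** Every vertex has the same label average. Summing over the [k] labels turns the weights [p] and
    [1 - p] into [1] and [k - 1]. *)
Lemma label_avg_type_value : label_avg type_value = Rd_tilde k lam.
Proof.
have E s : label_avg (fun b => Rd cpl (vertex s) b) = Rd_tilde k lam.
  transitivity (label_avg (fun b : labels => 1 - (2 * k%:R)^-1 +
      - 4^-1 * \sum_y `|P_Y (vertex s) b y - p|)).
    congr (_ * _); apply: eq_bigr => b _; rewrite capped_RdE ?mulNr //.
    exact: capped_vertex.
  rewrite label_avgD label_avgZ label_avg_cst // label_avg_sum mulNr.
  congr (_ - _ * _); under eq_bigr do rewrite label_avg_vertex_dev.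
  rewrite sumr_const card_ord -[LHS]mulr_natl mulr_sumr.
  apply: eq_bigr => c _; rewrite mulrCA; congr (_ * _).
  have -> : c%:R * lam + (1 - t%:R * lam) - p = (c%:R - t%:R) * lam + (1 - p).
    by ring.
  by field; rewrite pnatr_eq0 -lt0n.
rewrite -[RHS](@perm_avg_cst R m) /label_avg /type_value.
rewrite -mulr_sumr exchange_big mulrCA mulr_sumr; congr (_ * _).
by apply: eq_bigr => s _; rewrite -(E s).
Qed.

(** With [C = 4N/m^2] the class sums lose at most [C/2 * m = 2N/m], and the factor [1/4] in the
    detection formula leaves [N/(2m)]. *)
Lemma type_value_le (b : labels) :
  type_value b <= Rd_tilde k lam + (Num.ceil lam^-1)%:~R / (2 * m%:R).
Proof.
have il : 0 < lam^-1 by rewrite invr_gt0.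
pose N := `|Num.ceil lam^-1|%N.
have NE : (Num.ceil lam^-1)%:~R = N%:R :> R.
  by rewrite [RHS]pmulrn gez0_abs // ceil_ge0 (lt_trans (ltrN10 R) il).
have [q0 q1 _] := proj1 (capped_pmfP lam lam0 q) (capped_extremal lam lam0 hm m0).
(* Only [i = t] needs care: then [1/lam <= N <= t] gives [t * lam = 1], so the remainder is [0]. *)
have qN (i : 'I_m) : (N <= i)%N -> q i = 0.
  rewrite -(ler_nat R) -NE => /(le_trans (ceil_ge _)) h.
  have ti : (t <= i)%N.
    by rewrite -(ler_nat R); apply: le_trans h; rewrite truncn_le ltW.
  rewrite /extremal ltnNge ti /=; case: eqP => // it.
  have /andP[h1 _] := truncn_bounds lam lam0.
  apply/eqP; rewrite subr_eq0 eq_le h1 andbT.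
  by rewrite -ler_pdivrMr // div1r -it.
have C0 : 0 <= 4 * N%:R / m%:R ^+ 2 :> R.
  by rewrite divr_ge0 ?exprn_ge0 ?mulr_ge0 ?ler0n.
have := label_avg_le_class_sum R k m _ (avg_dev q p) b k0 m0 C0
  (fun n => avg_dev_second_diff q p N n q0 q1 qN).
rewrite -label_avg_type_value type_valueE.
have -> : label_avg type_value = 1 - (2 * k%:R)^-1 + - 4^-1 *
   label_avg (fun b' : labels => \sum_s avg_dev q p #|label_class b' s|).
  rewrite -label_avgZ -[X in X + _](@label_avg_cst R k m k0) -label_avgD.
  by congr (_ * _); apply: eq_bigr => b' _; rewrite type_valueE mulNr.
rewrite NE; have -> : N%:R / (2 * m%:R) = 4^-1 * (4 * N%:R / m%:R ^+ 2 / 2 * m%:R) :> R.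
  by field; rewrite pnatr_eq0 -lt0n.
lra.
Qed.

Lemma Rd_tilde_star_dist : `|Rd_tilde k lam - Rd_star cpl lam| <=
  (Num.ceil lam^-1)%:~R / (2 * m%:R).
Proof.
have [b [_ -> bmax]] := Rd_starP.
have h1 := type_value_le b.
(* A maximum is at least the mean, so [Rd_tilde] never exceeds [Rd_star]. *)
have h2 : Rd_tilde k lam <= type_value b.
  rewrite -label_avg_type_value -[leRHS](@label_avg_cst R k m k0).
  exact: le_label_avg.
by rewrite ler0_norm; lra.
Qed.

End MaxMin.

(** The coupling rules form a family indexed by [m], because the asymptotic claim fixes [k] and
    [lam] and lets [m] grow. *)
Theorem theorem4 (R : realType) (k : nat) (hk : (0 < k)%N)
    (lam : R) (hlam0 : 0 < lam) (hlam1 : lam <= 1)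
    (cpl : forall m : nat, coupling_rule R k m)
    (hcpl : forall m : nat, maximal_rule (cpl m)) :
  (forall m : nat, (0 < m)%N -> m%:R^-1 <= lam ->
     max_min_attained (cpl m) lam /\
     `|Rd_tilde k lam - Rd_star (cpl m) lam|
       <= 2 * k%:R * (Num.ceil lam^-1)%:~R / m%:R) /\
  (fun m : nat => Rd_tilde k lam - Rd_star (cpl m) lam : R)
    =O_\oo (fun m : nat => m%:R^-1 : R).
Proof.
have cl : 0 < (Num.ceil lam^-1)%:~R :> R.
  by rewrite (lt_le_trans _ (ceil_ge _)) // invr_gt0.
have main (m : nat) : (0 < m)%N -> m%:R^-1 <= lam ->
     max_min_attained (cpl m) lam /\
     `|Rd_tilde k lam - Rd_star (cpl m) lam|
       <= 2 * k%:R * (Num.ceil lam^-1)%:~R / m%:R.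
  move=> m0 hm; have [b [att _ _]] := Rd_starP lam (cpl m) hk m0 hlam0 hm (hcpl m).
  split=> //; apply: le_trans (Rd_tilde_star_dist lam _ hk m0 hlam0 hm (hcpl m)) _.
  have m0' : 0 < m%:R :> R by rewrite ltr0n.
  (* The factor [1/2] obtained above is at most [2 * k]. *)
  have k1 : 1 <= k%:R :> R by rewrite ler1n.
  rewrite invfM mulrA ler_pM2r ?invr_gt0 //; nra.
split=> //; apply/eqO_exP; exists (2 * k%:R * (Num.ceil lam^-1)%:~R).
  by rewrite !mulr_gt0 ?ltr0n.
(* The bound applies once [m > 0] and [m >= 1/lam], hence eventually. *)
near=> m.
have m0 : (0 < m)%N by near: m; exact: nbhs_infty_gt.
have hm : m%:R^-1 <= lam.
  rewrite invf_ple ?posrE ?ltr0n //; near: m; exact: nbhs_infty_ger.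
have [_ h] := main m m0 hm; apply: le_trans h _.
by rewrite ger0_norm // invr_ge0 ler0n.
Unshelve. all: by end_near.
Qed.
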